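(* Let $G$ be a finitely generated abelian group. There exists a symmetric subset $S$ of $G$ such that $\mathrm{Cay}(G,S)$ is connected and has chromatic number exactly $3$ if and only if $\exp(G)\notin\{1,2,4\}$.
   Context: A subset $S$ of an abelian group $G$ (written additively) is symmetric if $s\in S$ iff $-s\in S$. $\mathrm{Cay}(G,S)$ is the graph on vertex set $G$ with $x,y$ adjacent iff $y-x\in S$. The exponent $\exp(G)$ is the least positive integer $k$ with $kg=0$ for all $g\in G$, and $\exp(G)=0$ if no such $k$ exists. *)

(* Defs.v *)
From mathcomp Require Import all_boot all_order all_algebra.
From mathcomp Require Import boolp classical_sets.

Set Implicit Arguments.
Unset Strict Implicit.
Unset Printing Implicit Defensive.

Import GRing.Theory.

Local Open Scope ring_scope.

Definition finitely_generated (G : zmodType) : Prop :=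
  exists (n : nat) (X : n.-tuple G), forall g : G, inIntSpan X g.

Definition annihilates (G : zmodType) (k : nat) : Prop :=
  (0 < k)%N /\ forall g : G, g *+ k = 0.

Lemma ex_annihilates (G : zmodType) :
  (exists k, annihilates G k) -> exists k, `[< annihilates G k >].
Proof. by move=> [k Gk]; exists k; apply/asboolP. Qed.

Definition exponent (G : zmodType) : nat :=
  match pselect (exists k, annihilates G k) with
  | left exk => ex_minn (ex_annihilates exk)
  | right _ => 0%N
  end.

Definition symmetric_subset (G : zmodType) (S : set G) : Prop :=
  forall s : G, S s <-> S (- s).

(* Graphs are given by their adjacency relation. Loops are not excluded here:
   Cay S has loops iff S contains 0, and then it has no proper colouring. *)
Definition Cay (G : zmodType) (S : set G) : rel G := fun x y => y - x \in S.

Definition connected_graph (V : eqType) (adj : rel V) : Prop :=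
  forall x y : V, exists p : seq V, path adj x p /\ last x p = y.

Definition colorable (V : eqType) (adj : rel V) (k : nat) : Prop :=
  exists c : V -> 'I_k, forall x y : V, adj x y -> c x <> c y.

Definition has_chromatic_number (V : eqType) (adj : rel V) (k : nat) : Prop :=
  colorable adj k /\ forall j : nat, colorable adj j -> (k <= j)%N.

(* Main.v *)
(** If [4 g = 0] for all [g], lift the colour differences of a proper 3-colouring
    along edges to integers [+1] or [-1], and let the winding of a walk be their
    sum. Two walks with the same endpoints have windings that agree mod 3; if also
    their lengths have the same parity and total less than 6, then the windings
    are equal. Hence the winding does not change when steps are permuted, and it
    vanishes on the closed walk [s, s, s, s]. A closed walk [l] repeated four times
    permutes into blocks [s, s, s, s], so the winding of [l] is 0; as its parity is
    that of the length of [l], there are no odd closed walks, and the graph is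
    bipartite.

    A 3-chromatic connected Cayley graph pulls back along an epimorphism, so in the
    other direction it is enough to map [G] onto [Z/p] with [p] odd (an odd cycle)
    or onto [Z/8] (the Moebius ladder). Since [exp G = 0] is divisible by everything,
    [exp G] not being 1, 2 or 4 means that it is divisible by an odd prime or by 8.
    Now let [p^(j+1)] divide [exp G]. By Nakayama's lemma some [p^j g] is not in
    [p^(j+1) G], and modulo a subgroup containing [p^(j+1) G] and maximal among
    those avoiding [p^j g], the group [G] is cyclic of order [p^(j+1)], generated
    by [g]. *)
Require Import Defs.
From HB Require Import structures.
From mathcomp Require Import all_boot all_order all_algebra.
From mathcomp Require Import boolp classical_sets.
From mathcomp Require Import zify.

Set Implicit Arguments.
Unset Strict Implicit.
Unset Printing Implicit Defensive.

Import GRing.Theory.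

Local Open Scope ring_scope.

Lemma colorable_hom (V W : eqType) (adjV : rel V) (adjW : rel W) (h : V -> W)
    (k : nat) :
  {homo h : x y / adjV x y >-> adjW x y} -> colorable adjW k -> colorable adjV k.
Proof.
by move=> hom_h [c proper_c]; exists (c \o h) => x y /hom_h; apply: proper_c.
Qed.

Lemma colorable_leq (V : eqType) (adj : rel V) (j k : nat) :
  (j <= k)%N -> colorable adj j -> colorable adj k.
Proof.
move=> le_jk [c proper_c]; exists (widen_ord le_jk \o c) => x y /proper_c.
by apply: contra_not => /(congr1 val) /= /val_inj.
Qed.

Lemma has_chromatic_numberS (V : eqType) (adj : rel V) (k : nat) :
  colorable adj k.+1 -> ~ colorable adj k -> has_chromatic_number adj k.+1.
Proof.
move=> colk1 ncolk; split=> // j colj; rewrite ltnNge; apply/negP => le_jk.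
exact/ncolk/(colorable_leq le_jk).
Qed.

Section Walks.

Variables (G : zmodType) (S : set G).
Implicit Types (x y g s : G) (l p : seq G).

Lemma Cay_addr x s : Cay S x (x + s) = (s \in S).
Proof. by rewrite /Cay /= addrC addKr. Qed.

Definition steps x p : seq G := pairmap (fun u v => v - u) x p.

Lemma path_CayE x p : path (Cay S) x p = all [in S] (steps x p).
Proof. by elim: p x => //= y p IHp x; rewrite IHp. Qed.

Lemma sum_steps x p : \sum_(s <- steps x p) s = last x p - x.
Proof.
elim: p x => [|y p IHp] x /=; first by rewrite big_nil subrr.
by rewrite big_cons IHp addrC subrKA.
Qed.

Lemma connected_CayP :
  connected_graph (Cay S) <-> forall g, exists l, all [in S] l /\ \sum_(s <- l) s = g.
Proof.
split=> [conS g | genS x y].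
  have [p [xp lastp]] := conS 0 g; exists (steps 0 p).
  by rewrite -path_CayE sum_steps lastp subr0.
have [l [Sl suml]] := genS (y - x); exists (scanl +%R x l).
have stepsK : steps x (scanl +%R x l) = l by apply: scanlK => u v; rewrite addrC addKr.
rewrite path_CayE stepsK; split=> //.
by apply: (@addIr _ (- x)); rewrite -sum_steps stepsK.
Qed.

Definition closed_walk l : bool := all [in S] l && (\sum_(s <- l) s == 0).

Lemma colorable2_even_closed_walk l :
  colorable (Cay S) 2 -> closed_walk l -> ~~ odd (size l).
Proof.
move=> [c proper_c] /andP[Sl /eqP suml].
have alternates x : all [in S] l -> (c (x + \sum_(s <- l) s) == c x) = ~~ odd (size l).
  elim: l x {Sl suml} => [|s l IHl] x /=; first by rewrite big_nil addr0 eqxx.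
  case/andP => Ss Sl; rewrite big_cons addrA -(IHl (x + s) Sl).
  have := @proper_c x (x + s); rewrite Cay_addr => /(_ Ss).
  move: (c _) (c _) (c _).
  by move=> [[|[|//]] ?] [[|[|//]] ?] [[|[|//]] ?] //; case; apply: val_inj.
by rewrite -(alternates 0 Sl) suml addr0.
Qed.

Lemma even_closed_walks_colorable2 :
  symmetric_subset S -> connected_graph (Cay S) ->
  (forall l, closed_walk l -> ~~ odd (size l)) -> colorable (Cay S) 2.
Proof.
move=> symS /connected_CayP/choice[w /all_and2[Sw sumw]] evenS.
exists (fun x => inord (odd (size (w x)))) => x y.
rewrite /Cay => Sxy /(congr1 val) /=; rewrite !inordK ?ltnS ?leq_b1 // => same_parity.
have /evenS : closed_walk (w x ++ (y - x) :: map -%R (w y)).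
  apply/andP; split.
    rewrite all_cat Sw /= Sxy all_map; apply: sub_all (Sw y) => s /=.
    by rewrite !inE => /symS.
  by rewrite big_cat big_cons big_map sumrN /= !sumw addrA subrKC subrr.
by rewrite size_cat /= size_map oddD /=; move: same_parity; do 2 case: odd.
Qed.

End Walks.

(* The lift to [+1] or [-1] of the difference mod 3 of two distinct colours. *)
Definition color_step (a b : 'I_3) : int :=
  if (a.+1 %% 3 == b)%N then 1 else -1.

Lemma color_step_mod3 (a b : 'I_3) :
  a <> b -> (color_step a b = b%:Z - a%:Z %[mod 3])%Z.
Proof.
by case: a b => [[|[|[|//]]] ?] [[|[|[|//]]] ?] // ne_ab; case: ne_ab; apply: val_inj.
Qed.

Section Winding.

Variables (G : zmodType) (c : G -> 'I_3).
Implicit Types (x s t : G) (l : seq G).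

Fixpoint winding x l : int :=
  if l is s :: l' then color_step (c x) (c (x + s)) + winding (x + s) l' else 0.

Lemma winding_cat x l1 l2 :
  winding x (l1 ++ l2) = winding x l1 + winding (x + \sum_(s <- l1) s) l2.
Proof.
elim: l1 x => [|s l1 IHl1] x /=; first by rewrite big_nil addr0 add0r.
by rewrite IHl1 big_cons !addrA.
Qed.

Lemma winding_mod2 x l : (winding x l = size l %[mod 2])%Z.
Proof.
elim: l x => [|s l IHl] x //=; have := IHl (x + s); rewrite /color_step.
by case: ifP => _; lia.
Qed.

Lemma normr_winding_le x l : `|winding x l| <= (size l)%:Z.
Proof.
elim: l x => [|s l IHl] x //=; have := IHl (x + s); rewrite /color_step.
by case: ifP => _; lia.
Qed.

Variable S : set G.
Hypothesis proper_c : forall x y, Cay S x y -> c x <> c y.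

Lemma winding_mod3 x l : all [in S] l ->
  (winding x l = (c (x + \sum_(s <- l) s))%:Z - (c x)%:Z %[mod 3])%Z.
Proof.
elim: l x => [|s l IHl] x /=; first by rewrite big_nil addr0 subrr.
case/andP => Ss /(IHl (x + s)) IHxs; rewrite big_cons addrA -modzDm IHxs.
rewrite color_step_mod3; last by apply: proper_c; rewrite Cay_addr.
by rewrite modzDm [_ - _ + _]addrC subrKA.
Qed.

(* The difference of the two windings is even, divisible by 3, and at most 5 in
   absolute value. *)
Lemma short_winding_eq x l1 l2 : all [in S] l1 -> all [in S] l2 ->
  \sum_(s <- l1) s = \sum_(s <- l2) s -> odd (size l1) = odd (size l2) ->
  (size l1 + size l2 < 6)%N -> winding x l1 = winding x l2.
Proof.
move=> /(winding_mod3 x) + /(winding_mod3 x) + sum12; rewrite sum12.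
move: (winding_mod2 x l1) (winding_mod2 x l2).
by move: (normr_winding_le x l1) (normr_winding_le x l2); lia.
Qed.

Lemma winding_move_to_front x s l1 l2 : all [in S] (s :: l1) ->
  winding x (l1 ++ s :: l2) = winding x (s :: l1 ++ l2).
Proof.
elim: l1 x => [//|t l1 IHl1] x /=; case/and3P => Ss St Sl1.
rewrite IHl1 /= ?Ss // !addrA [x + s + t]addrAC; congr (_ + _).
have := @short_winding_eq x [:: t; s] [:: s; t].
rewrite /= Ss St !addr0 [x + s + t]addrAC; apply=> //.
by rewrite !big_cons !big_nil !addr0 addrC.
Qed.

Lemma winding_perm x l1 l2 : all [in S] l1 -> perm_eq l1 l2 ->
  winding x l1 = winding x l2.
Proof.
elim: l1 x l2 => [|s l1 IHl1] x l2; first by move=> _; rewrite perm_sym => /perm_nilP->.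
move=> Sl1 perm12; have Sl2 : all [in S] l2 by rewrite -(perm_all _ perm12).
have s_l2 : s \in l2 by rewrite -(perm_mem perm12) mem_head.
case/splitPr: l2 / s_l2 perm12 Sl2 => [l2 l3] perm12 Sl2.
rewrite winding_move_to_front; last first.
  by move: Sl2; rewrite all_cat /= andbCA => /and3P[-> ->].
rewrite /=; congr (_ + _); apply: IHl1; first by case/andP: Sl1.
rewrite -(perm_cons s); apply: perm_trans perm12 _.
exact/permPl/(perm_catCA l2 [:: s]).
Qed.

Hypothesis G4 : forall g : G, g *+ 4 = 0.

Lemma winding_flatten_nseq4 x l : all [in S] l ->
  winding x (flatten [seq nseq 4 s | s <- l]) = 0.
Proof.
elim: l x => [//|s l IHl] x /andP[Ss Sl].
have -> : flatten [seq nseq 4 t | t <- s :: l]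
    = nseq 4 s ++ flatten [seq nseq 4 t | t <- l] by [].
rewrite winding_cat IHl // addr0.
apply: (@short_winding_eq x _ [::]); rewrite ?all_nseq ?Ss //.
by rewrite big_nil big_nseq iter_addr_0 G4.
Qed.

Lemma even_closed_walk_exp4 l : closed_walk S l -> ~~ odd (size l).
Proof.
case/andP => Sl /eqP suml.
have perm4 : perm_eq (flatten [seq nseq 4 s | s <- l]) (l ++ l ++ l ++ l).
  by apply/permP => a; rewrite !count_cat; elim: l {Sl suml} => //= s l ->; lia.
have winding4 : winding 0 (l ++ l ++ l ++ l) = 0.
  rewrite -(winding_perm _ _ perm4) ?winding_flatten_nseq4 //.
  by rewrite (perm_all _ perm4) !all_cat Sl.
by move: winding4 (winding_mod2 0 l); rewrite !winding_cat suml !addr0; lia.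
Qed.

End Winding.

Lemma Cay_exp4_colorable2 (G : zmodType) (S : set G) :
  (forall g : G, g *+ 4 = 0) -> symmetric_subset S -> connected_graph (Cay S) ->
  colorable (Cay S) 3 -> colorable (Cay S) 2.
Proof.
move=> G4 symS conS [c proper_c].
apply: even_closed_walks_colorable2 => // l.
exact: even_closed_walk_exp4 proper_c G4 l.
Qed.

Definition has_Cay_of_chromatic_number (G : zmodType) (k : nat) : Prop :=
  exists S : set G,
    symmetric_subset S /\ connected_graph (Cay S) /\ has_chromatic_number (Cay S) k.

Section Preimage.

Variables (G H : zmodType) (f : {additive G -> H}) (T : set H).
Hypothesis f_surj : forall b, exists x, f x = b.

(* A section of [f] is a graph homomorphism from [Cay T] to the Cayley graph of
   the preimage of [T]. *)
Lemma colorable_Cay_preimage (k : nat) :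
  colorable (Cay (f @^-1` T)%classic) k <-> colorable (Cay T) k.
Proof.
have [r fr] := choice f_surj.
split; [apply: (colorable_hom (h := r)) | apply: (colorable_hom (h := f))].
- by move=> a b; rewrite /Cay !inE /= raddfB !fr.
- by move=> x y; rewrite /Cay !inE /= raddfB.
Qed.

Lemma connected_Cay_preimage (t : H) :
  T t -> connected_graph (Cay T) -> connected_graph (Cay (f @^-1` T)%classic).
Proof.
move=> Tt /connected_CayP genT; apply/connected_CayP => x.
have [r fr] := choice f_surj; have [l [Tl suml]] := genT (f x - t).
(* The last step of the lifted walk absorbs the kernel of [f]. *)
exists (rcons (map r l) (x - \sum_(s <- map r l) s)); split; last first.
  by rewrite big_rcons /= subrKC.
rewrite all_rcons all_map; apply/andP; split.
  rewrite inE /= raddfB raddf_sum big_map (eq_bigr id) => [|s _]; last exact: fr.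
  by rewrite suml opprB addrC subrK.
by apply: sub_all Tl => s; rewrite /= !inE /= fr.
Qed.

End Preimage.

Lemma has_Cay_of_chromatic_number_surj (G H : zmodType) (f : {additive G -> H})
    (k : nat) :
  (1 < k)%N -> (forall b, exists x, f x = b) ->
  has_Cay_of_chromatic_number H k -> has_Cay_of_chromatic_number G k.
Proof.
move=> k_gt1 f_surj [T [symT [conT [colT minT]]]].
have [t Tt] : exists t, T t.
  apply: contrapT => /forallNP T0; have /minT : colorable (Cay T) 1; last by lia.
  by exists (fun=> ord0) => x y; rewrite /Cay inE => /T0.
exists (f @^-1` T)%classic; split; first by move=> s; rewrite /= raddfN; apply: symT.
split; first exact: connected_Cay_preimage Tt conT.
by split=> [|j]; rewrite colorable_Cay_preimage //; apply: minT.
Qed.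

Lemma connected_Cay_Zp (n : nat) (T : set 'Z_n) : T 1 -> connected_graph (Cay T).
Proof.
move=> T1; apply/connected_CayP => a; exists (nseq a 1).
by rewrite all_nseq mem_set // orbT big_nseq iter_addr_0 natr_Zp.
Qed.

Lemma symmetric_set1N (G : zmodType) (x : G) : symmetric_subset [set x; - x]%classic.
Proof.
by move=> s; split=> [[->|->]|[<-|/oppr_inj->]]; rewrite ?opprK; [right|left|right|left].
Qed.

Definition cycle_color (n : nat) (a : 'Z_n) : 'I_3 :=
  if a == -1 then inord 2 else inord (odd a).

Lemma cycle_color_succ (n : nat) (a : 'Z_n) : cycle_color a <> cycle_color (a + 1).
Proof.
have ltb3 (b : bool) : (b < 3)%N by case: b.
rewrite /cycle_color; have [->|a_neqN1] := eqVneq a (-1).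
  by rewrite addNr eq_sym oppr_eq0 oner_eq0 => /(congr1 val); rewrite /= !inordK.
have val_a1 : a + 1 = a.+1 :> nat.
  move: a_neqN1 (ltn_ord a); rewrite -val_eqE /= (@modn_small 1) //.
  by rewrite (modn_small (ltnSn _)) => neq_max lt_a; rewrite modn_small; lia.
move=> /(congr1 val); rewrite val_a1.
by case: ifP => _; rewrite /= !inordK //=; case: odd.
Qed.

Lemma has_Cay_of_chromatic_number3_Zp_odd (n : nat) :
  (1 < n)%N -> odd n -> has_Cay_of_chromatic_number 'Z_n 3.
Proof.
move=> n_gt1 odd_n; pose T : set 'Z_n := [set 1; -1]%classic; exists T.
split; first exact: symmetric_set1N.
split; first by apply: connected_Cay_Zp; left.
apply: has_chromatic_numberS.
  exists (@cycle_color n) => a b; rewrite /Cay inE => -[/eqP|/eqP].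
    by rewrite subr_eq addrC => /eqP->; apply: cycle_color_succ.
  by rewrite subr_eq addrC eq_sym subr_eq => /eqP->; apply/nesym/cycle_color_succ.
have walk : closed_walk T (nseq n 1).
  rewrite /closed_walk all_nseq mem_set ?orbT /=; last by left.
  by rewrite big_nseq iter_addr_0 pchar_Zp.
by move=> /colorable2_even_closed_walk/(_ walk); rewrite size_nseq odd_n.
Qed.

Definition moebius_ladder_color (a : 'Z_8) : 'I_3 :=
  inord (nth 0 [:: 0; 1; 0; 1; 2; 0; 1; 2] a)%N.

Lemma has_Cay_of_chromatic_number3_Z8 : has_Cay_of_chromatic_number 'Z_8 3.
Proof.
pose T : set 'Z_8 := [set` [:: 1; -1; 4%:R]]%classic; exists T; split.
  by case=> [[|[|[|[|[|[|[|[|//]]]]]]]] ?]; split.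
split; first exact: connected_Cay_Zp.
apply: has_chromatic_numberS.
  exists moebius_ladder_color => a b.
  rewrite /Cay inE.
  by move: a b => [[|[|[|[|[|[|[|[|//]]]]]]]] ?] [[|[|[|[|[|[|[|[|//]]]]]]]] ?] //= _
    /(congr1 val) /=; rewrite !inordK.
have walk : closed_walk T [:: 4%:R; 1; 1; 1; 1].
  by apply/andP; split; [rewrite /= !mem_set | rewrite !big_cons big_nil].
by move=> /colorable2_even_closed_walk/(_ walk).
Qed.

Lemma Zp_intr_eq0 (n : nat) (k : int) : (1 < n)%N -> (k%:~R == 0 :> 'Z_n) = (n %| k)%Z.
Proof.
move=> n_gt1; have natr_eq0 m : (m%:R == 0 :> 'Z_n) = (n %| m)%N.
  by rewrite -val_eqE /= val_Zp_nat.
by case: k => m; rewrite ?NegzE ?mulrNz ?oppr_eq0 dvdzE ?abszN -pmulrn natr_eq0.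
Qed.

Section MaximalAvoiding.

Variables (G : zmodType) (K : {pred G}) (x : G).
Hypotheses (zmodK : zmod_closed K) (xK : x \notin K).

(* The empty set is admitted so that the union of the empty chain qualifies. *)
Definition avoiding_subgroup (A : set G) : Prop :=
  [/\ forall u v, A u -> A v -> A (u - v),
      (exists u, A u) -> forall u, u \in K -> A u
    & ~ A x].

Lemma bigcup_avoiding_subgroup (F : set (set G)) :
  (F `<=` avoiding_subgroup)%classic -> total_on F subset ->
  avoiding_subgroup (\bigcup_(X in F) X)%classic.
Proof.
move=> F_avoid F_total; split.
- move=> u v [A FA Au] [B FB Bv].
  have [AB|BA] := F_total A B FA FB.
    by exists B => //; have [subB _ _] := F_avoid _ FB; apply: subB => //; apply: AB.
  by exists A => //; have [subA _ _] := F_avoid _ FA; apply: subA => //; apply: BA.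
- move=> [u [A FA Au]] v Kv; exists A => //.
  by have [_ KA _] := F_avoid _ FA; apply: KA => //; exists u.
- by move=> [A FA Ax]; have [_ _] := F_avoid _ FA.
Qed.

Lemma exists_maximal_avoiding : exists H : zmodClosed G,
  [/\ {subset K <= H}, x \notin H
    & forall y, y \notin H -> exists k : int, x - y *~ k \in H].
Proof.
have [A [[subA KA Ax] maxA]] := Zorn_bigcup bigcup_avoiding_subgroup.
have [K0 KB] := zmodK.
have [a Aa] : exists a, A a.
  apply: contrapT => /forallNP A0; apply: (maxA [set u | u \in K]%classic).
    by split=> [u /A0 //|/(_ 0 K0)]; apply: A0.
  by split=> //; exact/negP.
have A0 : A 0 by rewrite -(subrr a); apply: subA.
have zmodA : zmod_closed [pred u | u \in A].
  by split=> [|u v]; rewrite !inE //; apply: subA.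
pose H : zmodClosed G :=
  HB.pack (fun u => u \in A) (GRing.isZmodClosed.Build _ _ zmodA).
have HE u : (u \in H) = (u \in A) by [].
exists H; split.
- by move=> u Ku; rewrite HE mem_set //; apply: KA => //; exists a.
- by rewrite HE memNset.
move=> y; rewrite HE notin_setE => Ay.
pose B := [set u | exists k : int, A (u - y *~ k)]%classic.
have AB : (A `<=` B)%classic by move=> u Au; exists 0; rewrite mulr0z subr0.
have /maxA : (A `<` B)%classic.
  by split=> // BA; apply/Ay/BA; exists 1; rewrite mulr1z subrr.
move=> notB; apply: contrapT => notBx; apply: notB; split.
- move=> u v [k Au] [l Av]; exists (k - l).
  by have := subA _ _ Au Av; rewrite mulrzBr !opprD !opprK addrACA.
- by move=> _ u Ku; apply/AB/KA => //; exists a.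
- by case=> k Ak; apply: notBx; exists k; rewrite HE mem_set.
Qed.

End MaximalAvoiding.

(* [H] contains p^(j+1) G and is maximal among the subgroups avoiding p^j g, so
   that p^j g lies in every nonzero subgroup of G/H. *)
Section MaximalAvoidingPrimePower.

Variables (G : zmodType) (H : zmodClosed G) (p j : nat) (g : G).
Hypotheses (p_pr : prime p) (H_pexp : forall x, x *+ p ^ j.+1 \in H).
Hypothesis gH : g *+ p ^ j \notin H.
Hypothesis maxH : forall y, y \notin H -> exists k : int, g *+ p ^ j - y *~ k \in H.

Lemma mulrz_memE (k : int) : (g *~ k \in H) = ((p ^ j.+1)%N %| k)%Z.
Proof.
apply/idP/idP => [gkH|/dvdzP[q ->]]; last by rewrite mulrzA -pmulrn H_pexp.
have [u [v uv]] := Bezoutz k (p ^ j.+1)%N.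
have gcdH : g *+ gcdn `|k| (p ^ j.+1) \in H.
  rewrite pmulrn -[Posz _]uv mulrzDr [u * k]mulrC !mulrzA -pmulrn.
  by rewrite rpredD ?H_pexp // rpredMz.
have /(dvdn_pfactor _ _ p_pr)[i le_i_jS gcdE] := dvdn_gcdr `|k| (p ^ j.+1).
have [le_ij|lt_ji] := leqP i j.
  case/negP: gH; rewrite -(subnKC le_ij) expnD mulrnA rpredMn //.
  by rewrite gcdE in gcdH.
have -> : (p ^ j.+1 = gcdn `|k| (p ^ j.+1))%N by rewrite gcdE; congr (_ ^ _)%N; lia.
by rewrite dvdzE dvdn_gcdl.
Qed.

Lemma coset_contains_multiple_of_pmul (y : G) :
  y *+ p \in H -> exists k : int, y - g *~ k \in H.
Proof.
have [yH _|/maxH[m gmH] pyH] := boolP (y \in H).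
  by exists 0; rewrite mulr0z subr0.
have p_ndvd_m : ~~ (p %| m)%Z.
  apply: contra gH => /dvdzP[q m_eq].
  have ymH : y *~ m \in H by rewrite m_eq mulrC mulrzA -pmulrn rpredMz.
  by rewrite (rpredBr _ ymH) in gmH.
have /coprimezP[[u v] /= uv] : coprimez m p.
  by rewrite coprimezE coprime_sym prime_coprime.
exists (u * (p ^ j)%N).
have -> : y - g *~ (u * (p ^ j)%N) = (y *+ p) *~ v - (g *+ p ^ j - y *~ m) *~ u.
  rewrite -{1}[y]mulr1z -uv mulrzDr mulrzBl opprB.
  rewrite [u * m]mulrC [v * p]mulrC [u * (p ^ j)%N]mulrC !mulrzA -!pmulrn.
  by rewrite addrAC addrC.
by rewrite rpredB ?rpredMz.
Qed.

Lemma coset_contains_multiple (x : G) : exists k : int, x - g *~ k \in H.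
Proof.
have descend i : forall y, y *+ p ^ i \in H -> exists k : int, y - g *~ k \in H.
  elim: i => [|i IHi] y; first by exists 0; rewrite mulr0z subr0.
  rewrite expnS mulrnA => /IHi[k pyH].
  have /dvdzP[q k_eq] : (p %| k)%Z.
    have : (g *~ k) *+ p ^ j \in H.
      rewrite -(rpredBl _ (H_pexp y)) expnS mulrnA -mulrnBl.
      exact: rpredMn.
    rewrite pmulrn -mulrzA mulrz_memE expnS PoszM dvdz_mul2r //.
    by rewrite eqz_nat -lt0n expn_gt0 prime_gt0.
  have [|l yH] := @coset_contains_multiple_of_pmul (y - g *~ q).
    by rewrite mulrnBl pmulrn [X in _ - X]pmulrn -mulrzA -k_eq -pmulrn.
  by exists (q + l); rewrite mulrzDr opprD addrA.
exact: descend (H_pexp x).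
Qed.

End MaximalAvoidingPrimePower.

Lemma additive_of_cyclic_quotient (G : zmodType) (H : zmodClosed G) (n : nat) (g : G) :
  (1 < n)%N -> (forall k : int, (g *~ k \in H) = (n %| k)%Z) ->
  (forall x, exists k : int, x - g *~ k \in H) ->
  exists f : {additive G -> 'Z_n}, f g = 1.
Proof.
move=> n_gt1 ord_g /choice[k kH].
pose f x : 'Z_n := (k x)%:~R.
have f_eq x l : x - g *~ l \in H -> f x = l%:~R.
  move=> lH; apply/eqP; rewrite -subr_eq0 -rmorphB Zp_intr_eq0 // -ord_g.
  by have := rpredB lH (kH x); rewrite opprB addrC subrKA mulrzBr.
have fB : zmod_morphism f.
  move=> x y; transitivity ((k x - k y)%:~R : 'Z_n); last by rewrite rmorphB.
  apply: f_eq.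
  by have := rpredB (kH x) (kH y); rewrite mulrzBr !opprD !opprK addrACA.
exists (HB.pack f (GRing.isZmodMorphism.Build _ _ f fB) : {additive G -> 'Z_n}).
by rewrite /= (f_eq g 1) // mulr1z subrr rpred0.
Qed.

Lemma additive_onto_Zp_pexp (G : zmodType) (p j : nat) (g : G) :
  prime p -> (forall h, g *+ p ^ j <> h *+ p ^ j.+1) ->
  exists f : {additive G -> 'Z_(p ^ j.+1)}, forall a, exists x, f x = a.
Proof.
move=> p_pr g_notin; pose K := [pred x : G | `[< exists h, x = h *+ p ^ j.+1 >]].
have zmodK : zmod_closed K.
  split=> [|_ _ /asboolP[h ->] /asboolP[h' ->]]; apply/asboolP.
    by exists 0; rewrite mul0rn.
  by exists (h - h'); rewrite mulrnBl.
have gK : g *+ p ^ j \notin K by apply/asboolPn => -[h]; apply: g_notin.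
have [H [KH gH maxH]] := exists_maximal_avoiding zmodK gK.
have H_pexp x : x *+ p ^ j.+1 \in H by apply: KH; apply/asboolP; exists x.
have n_gt1 : (1 < p ^ j.+1)%N by rewrite -(exp1n j.+1) ltn_exp2r ?prime_gt1.
have [f fg] := additive_of_cyclic_quotient n_gt1
  (mulrz_memE p_pr H_pexp gH) (coset_contains_multiple p_pr H_pexp gH maxH).
by exists f => a; exists (g *+ a); rewrite raddfMn /= fg natr_Zp.
Qed.

Lemma det_scale_eq0 (R : comNzRingType) (V : lmodType R) (r : nat) (A : 'M[R]_r)
    (X : 'I_r -> V) :
  (forall i, \sum_(j < r) A i j *: X j = 0) -> forall i, \det A *: X i = 0.
Proof.
move=> AX i; transitivity (\sum_j (\adj A *m A) i j *: X j).
  rewrite mul_adj_mx (bigD1 i) //= big1 ?addr0 => [|j ne_ji]; first by rewrite mxE eqxx.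
  by rewrite mxE eq_sym (negPf ne_ji) scale0r.
under eq_bigr do rewrite mxE scaler_suml.
rewrite exchange_big big1 //= => k _; under eq_bigr do rewrite -scalerA.
by rewrite -scaler_sumr AX scaler0.
Qed.

Lemma det_1_sub_scale_eq0 (R : comNzRingType) (V : lmodType R) (r : nat) (a : R)
    (B : 'M[R]_r) (X : 'I_r -> V) :
  (forall i, X i = a *: \sum_j B i j *: X j) ->
  forall i, \det (1%:M - a *: B) *: X i = 0.
Proof.
move=> X_eq; apply: det_scale_eq0 => i.
under eq_bigr do rewrite !mxE scalerBl -scalerA.
rewrite sumrB -scaler_sumr -X_eq (bigD1 i) //= eqxx scale1r.
rewrite big1 ?addr0 ?subrr // => j ne_ji.
by rewrite eq_sym (negPf ne_ji) scale0r.
Qed.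

Lemma dvdz_det_1_sub_scale (p r : nat) (B : 'M[int]_r) :
  (1 < p)%N -> (p %| \det (1%:M - p%:Z *: B) - 1)%Z.
Proof.
move=> p_gt1; rewrite -Zp_intr_eq0 // rmorphB rmorph1 -det_map_mx subr_eq0.
have -> : map_mx (intmul 1) (1%:M - p%:Z *: B) = 1%:M :> 'M['Z_p]_r.
  by rewrite map_mxB map_mx1 map_mxZ /= -pmulrn pchar_Zp // scale0r subr0.
by rewrite det1.
Qed.

(* Nakayama's lemma for the ideal [p Z] and the module [m G]. *)
Lemma divisible_multiples_annihilated (G : zmodType) (m p : nat) :
  (1 < p)%N -> finitely_generated G ->
  (forall g : G, exists h, g *+ m = h *+ (m * p)) ->
  exists d : int, (p %| d - 1)%Z /\ forall g : G, (g *+ m) *~ d = 0.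
Proof.
move=> p_gt1 [r [X genX]] divG.
have divX (i : 'I_r) :
    exists b : int ^ r, X`_i *+ m = (\sum_(j < r) (X`_j *+ m) *~ b j) *+ p.
  have [h ->] := divG X`_i; have [b ->] := genX h; exists b.
  rewrite mulrnA -sumrMnl; congr (_ *+ _).
  by apply: eq_bigr => j _; rewrite !pmulrn mulrzAC.
have [b mX_eq] := choice divX.
pose mX (i : 'I_r) : zmodule G := X`_i *+ m; pose B := \matrix_(i, j) b i j.
exists (\det (1%:M - p%:Z *: B)); split; first exact: dvdz_det_1_sub_scale.
have det_mX : forall i, \det (1%:M - p%:Z *: B) *: mX i = 0.
  apply: det_1_sub_scale_eq0 => i; rewrite {1}/mX mX_eq scalezrE -pmulrn.
  by congr (_ *+ _); apply: eq_bigr => j _; rewrite mxE.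
move=> g; have [a ->] := genX g.
rewrite -sumrMnl mulrz_suml big1 // => i _.
by rewrite pmulrn [_ *~ m]mulrzAC -pmulrn mulrzAC [X in X *~ _](det_mX i) mul0rz.
Qed.

Lemma exponent_dvdn (G : zmodType) (k : nat) :
  (exponent G %| k)%N <-> forall g : G, g *+ k = 0.
Proof.
rewrite /exponent; case: pselect => [exk|no_k]; last first.
  split=> [|Gk]; first by rewrite dvd0n => /eqP->.
  by case: k Gk => [//|k] Gk; case: no_k; exists k.+1; split.
case: ex_minnP => n /asboolP[n_gt0 Gn] min_n; split=> [/dvdnP[q ->] g|Gk].
  by rewrite mulnC mulrnA Gn mul0rn.
have Gmod g : g *+ (k %% n) = 0 :> G.
  by rewrite -(Gk g) {2}(divn_eq k n) mulrnDr mulnC mulrnA Gn mul0rn add0r.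
rewrite /dvdn; apply: contraT; rewrite -lt0n => mod_gt0.
have /min_n : `[< annihilates G (k %% n) >] by apply/asboolP.
by rewrite leqNgt ltn_mod n_gt0.
Qed.

Lemma exists_multiple_pexp_of_dvdn_exponent (G : zmodType) (p j : nat) :
  finitely_generated G -> prime p -> (p ^ j.+1 %| exponent G)%N ->
  exists g : G, forall h, g *+ p ^ j <> h *+ p ^ j.+1.
Proof.
move=> fgG p_pr p_exponent; apply: contrapT => no_g.
have divG g : exists h : G, g *+ p ^ j = h *+ (p ^ j * p).
  apply: contrapT => /forallNP gh; apply: no_g; exists g => h.
  by rewrite expnSr; apply: gh.
have [d [p_dvd_d1 Gd]] := divisible_multiples_annihilated (prime_gt1 p_pr) fgG divG.
have : (p ^ j.+1 %| p ^ j * `|d|)%N.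
  apply: dvdn_trans p_exponent _; apply/exponent_dvdn => g.
  have := Gd g; rewrite mulrnA; case: d {p_dvd_d1 Gd} => d //.
  by rewrite NegzE mulrNz => /eqP; rewrite oppr_eq0 => /eqP.
rewrite expnSr dvdn_pmul2l ?expn_gt0 ?prime_gt0 // => p_dvd_d.
have : (p %| 1)%Z.
  by have := rpredBl 1 (p_dvd_d : d \in dvdz p); rewrite [d - 1 \in _]p_dvd_d1.
by rewrite dvdz1 /= => /eqP p1; rewrite p1 in p_pr.
Qed.

Local Close Scope ring_scope.

Lemma odd_prime_or_8_dvdn (n : nat) : n \notin [:: 1; 2; 4] ->
  (exists p, [/\ prime p, odd p & p %| n]) \/ 8 %| n.
Proof.
move=> n_notin; have [->|n_gt0] := posnP n; first by right.
have [?|no_odd] := pselect (exists p, [/\ prime p, odd p & p %| n]); [by left|right].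
have /p_natP[k n_eq] : 2.-nat n.
  apply/pnatP => // p p_pr p_n; rewrite inE.
  by case/even_prime: (p_pr) => [->//|odd_p]; case: no_odd; exists p.
move: n_notin; rewrite n_eq; case: k {n_eq} => [|[|[|k]]] // _.
exact: (@dvdn_exp2l 2 3).
Qed.

Theorem theorem5p1 (G : zmodType) (fgG : finitely_generated G) :
  (exists S : set G,
     symmetric_subset S /\ connected_graph (Cay S)
     /\ has_chromatic_number (Cay S) 3)
  <-> exponent G \notin [:: 1; 2; 4].
Proof.
split=> [[S [symS [conS [col3 min3]]]]|].
  apply/negP => exp_in; have /exponent_dvdn G4 : exponent G %| 4.
    by move: exp_in; rewrite !inE => /or3P[] /eqP->.
  by have /min3 := Cay_exp4_colorable2 G4 symS conS col3.
have onto_Zp p j : prime p -> p ^ j.+1 %| exponent G ->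
    has_Cay_of_chromatic_number 'Z_(p ^ j.+1) 3 -> has_Cay_of_chromatic_number G 3.
  move=> p_pr p_exponent.
  have [g g_pexp] := exists_multiple_pexp_of_dvdn_exponent fgG p_pr p_exponent.
  have [f f_surj] := additive_onto_Zp_pexp p_pr g_pexp.
  exact: has_Cay_of_chromatic_number_surj f_surj.
move=> /odd_prime_or_8_dvdn[[p [p_pr odd_p p_exponent]]|exponent8].
  apply: (onto_Zp p 0) => //; rewrite expn1 //.
  exact: has_Cay_of_chromatic_number3_Zp_odd (prime_gt1 p_pr) odd_p.
exact: (onto_Zp 2 2) has_Cay_of_chromatic_number3_Z8.
Qed.
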